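(* Let $f, g \colon \mathbb{R}^n \to \mathbb{R}^n$ be polynomial maps of positive degrees $d_f$ and $d_g$, respectively, and let $\mathfrak{m}^\infty(x) := \min\{f^\infty(x), g^\infty(x)\}$ (componentwise minimum). Suppose the following conditions hold: (i) $\mathfrak{m}^\infty(x) = 0 \Rightarrow x = 0$; and (ii) $\deg(\mathfrak{m}^\infty, 0) \ne 0$. Then, for any polynomial maps $p, q \colon \mathbb{R}^n \to \mathbb{R}^n$ of degree at most $d_f - 1$ and $d_g - 1$ respectively, the set $\mathrm{SOL}(f + p, g + q)$ is nonempty and compact.
   Context: A polynomial map $f\colon\mathbb{R}^n\to\mathbb{R}^n$ is written $f=\mathcal{A}_d+\mathcal{A}_{d-1}+\cdots+\mathcal{A}_0$ with each $\mathcal{A}_k\colon\mathbb{R}^n\to\mathbb{R}^n$ a polynomial map homogeneous of degree $k$; if $\mathcal{A}_d\neq 0$, the degree of $f$ is $d$ and its leading term is $f^\infty:=\mathcal{A}_d$ (homogeneous part of highest degree of the whole map). For polynomial maps $f,g\colon\mathbb{R}^n\to\mathbb{R}^n$, $\mathrm{SOL}(f,g):=\{x\in\mathbb{R}^n : f(x)\ge 0,\ g(x)\ge 0,\ \langle f(x),g(x)\rangle=0\}$, with vector inequalities componentwise. For a bounded open set $\Omega\subset\mathbb{R}^n$, a continuous map $h\colon\overline{\Omega}\to\mathbb{R}^n$ and $y\notin h(\partial\Omega)$, $\deg(h,\Omega,y)$ is the (Brouwer) topological degree. If $x^*$ is the unique solution of $h(x)=y$ in $\Omega$, then $\deg(h,\Omega',y)$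 is the same for all bounded open $\Omega'$ with $x^*\in\Omega'\subset\Omega$; this common value is the local degree of $h$ at $x^*$, denoted $\deg(h,x^* )$. *)

(* Defs.v *)
From HB Require Import structures.
From mathcomp Require Import all_boot all_order all_algebra.
From mathcomp Require Import all_classical all_reals all_analysis.
From mathcomp Require mpoly.
(* The notations of mpoly clash with those of analysis. *)
Import -(notations) mpoly.

Set Implicit Arguments.
Unset Strict Implicit.
Unset Printing Implicit Defensive.
Import Order.TTheory GRing.Theory Num.Theory.
Import numFieldNormedType.Exports.
Local Open Scope classical_set_scope.
Local Open Scope ring_scope.

(* R being infinite, polynomial maps R^n -> R^n are identified with row vectors
   of n polynomials in n variables. *)
Notation polymap R n := 'rV[mpoly n R]_n.

Definition peval (R : realType) (n : nat) (f : polymap R n) (x : 'rV[R]_n) :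
    'rV[R]_n :=
  map_mx (meval (x ord0)) f.

(* [mmeasure mdeg] is the total degree plus one, and 0 for the zero polynomial;
   the zero map is given degree 0. *)
Definition pdegree (R : realType) (n : nat) (f : polymap R n) : nat :=
  (\max_(i < n) (mmeasure mdeg (f ord0 i)).-1)%N.

(* The homogeneous part is taken in the degree of the whole map, not of each
   component, so some components of the leading term may vanish. *)
Definition plead (R : realType) (n : nat) (f : polymap R n) : polymap R n :=
  map_mx (pihomog mdeg (pdegree f)) f.

Definition SOL (R : realType) (n : nat) (f g : 'rV[R]_n -> 'rV[R]_n) :
    set 'rV[R]_n :=
  [set x | [/\ forall i, 0 <= f x ord0 i,
               forall i, 0 <= g x ord0 i &
               \sum_(i < n) f x ord0 i * g x ord0 i = 0]].

Definition vmin (R : realType) (n : nat) (u v : 'rV[R]_n) : 'rV[R]_n :=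
  \row_i Num.min (u ord0 i) (v ord0 i).

Definition minlead (R : realType) (n : nat) (f g : polymap R n) (x : 'rV[R]_n) :
    'rV[R]_n :=
  vmin (peval (plead f) x) (peval (plead g) x).

(* The Brouwer degree is defined analytically: for h continuous on the closure
   of a bounded open set W and y not in h(bd W), deg(h, W, y) is the common
   value of the signed counts of the solutions in W of g(x) = y, where g ranges
   over the maps continuous on the closure of W and C^1 in W, closer to h than
   y is to h(bd W), and having y as a regular value. Such maps exist by the
   Weierstrass and Sard theorems, and all yield the same integer. Any norm may
   be used to compare distances; the one of 'rV[R]_n is the maximum norm. *)

Section Degree.
Variables (R : realType) (n : nat).
Implicit Types (h g : 'rV[R]_n -> 'rV[R]_n) (W : set 'rV[R]_n) (x y : 'rV[R]_n).

Definition bd W := closure W `\` interior W.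

Definition admissible h W y : Prop :=
  [/\ open W, bounded_set W, {within closure W, continuous h} &
      ~ (h @` bd W) y].

Definition C1_on g W : Prop :=
  forall x, W x -> differentiable g x /\ {for x, continuous (jacobian g)}.

Definition regular_value g W y : Prop :=
  forall x, W x -> g x = y -> \det (jacobian g x) != 0.

(* On compact sets the pointwise strict inequalities in the last clause amount
   to: sup of |g - h| over the closure of W < distance from y to h(bd W). *)
Definition regular_approx h W y g : Prop :=
  [/\ {within closure W, continuous g}, C1_on g W, regular_value g W y &
      forall x z, closure W x -> bd W z -> `|g x - h x| < `|h z - y|].

(* The solution set is finite when y is a regular value not in g(bd W). *)
Definition signed_count g W y : int :=
  \sum_(x \in W `&` g @^-1` [set y]) sgz (\det (jacobian g x)).

(* The value is 0 outside of the domain of definition. *)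
Definition degree h W y : int :=
  xget 0 [set k : int | admissible h W y /\
                        forall g, regular_approx h W y g ->
                                  signed_count g W y = k].

(* The common value of deg(h, W', h x) for all open neighborhoods W' of x
   contained in some bounded open W in which x is the only solution of
   h(z) = h(x), there being none on bd W. The value is 0 if there is no such W. *)
Definition local_degree h x : int :=
  xget 0 [set k : int |
    exists W, [/\ admissible h W (h x), W `&` h @^-1` [set h x] = [set x] &
                  forall W', open W' -> W' x -> W' `<=` W ->
                             degree h W' (h x) = k]].

End Degree.

(* Main.v *)
Require Import Defs.
From HB Require Import structures.
From mathcomp Require Import all_boot all_order all_algebra.
From mathcomp Require Import all_classical all_reals all_analysis.
From mathcomp Require mpoly.
Import -(notations) mpoly.
From mathcomp Require Import ring lra.
Import Order.TTheory GRing.Theory Num.Theory.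
Import numFieldNormedType.Exports.
Local Open Scope classical_set_scope.
Local Open Scope ring_scope.

Set Implicit Arguments.
Unset Strict Implicit.
Unset Printing Implicit Defensive.

(** The solutions of the complementarity problem are the zeros of
    [min (F, G)], where [F = f + p] and [G = g + q] ([SOL_vmin]). Zooming out,
    that is, replacing [F x] by [t^df F(x / t)] and [G x] by [t^dg G(x / t)]
    for a small [t > 0], has two effects. It does not create zeros: for
    positive [a] and [b], [min (a u, b v)] vanishes exactly when [min (u, v)]
    does. And it brings [min (F, G)] uniformly close, on every ball, to
    [minlead f g], because all the terms of [f + p] other than the leading
    form of [f] get a positive power of [t] ([vmin_rescale_cvg]).

    Boundedness: by compactness [|minlead f g| >= c > 0] on the unit sphere. A
    solution [x] of large norm, rescaled with [t = 1 / |x|], would be a zero on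
    the sphere of a map that is within [c] of [minlead f g]. As the solution
    set is moreover closed, it is compact.

    Existence: a nonzero local degree makes roots stable. There are a bounded
    open set [W] and an [e > 0] such that each C^1 map [e]-close to
    [minlead f g] on the closure of [W] has a root in [W]: a map without any
    root there trivially has 0 as a regular value, so that it takes part in the
    definition of the degree, with an empty count ([local_degree_root]).
    If there were no solution, the rescaled minimum would have no zero, hence
    would be bounded away from 0 on the closure of [W]. Replacing [|c|] by
    [sqrt (c^2 + s^2)] in [min (a, b) = (a + b - |a - b|) / 2] turns it into a
    C^1 map, still without a root and still close to [minlead f g], which is a
    contradiction. *)

(** * Maps with values in matrices *)

Lemma rV_norm_lt (R : realType) n (v : 'rV[R]_n) (e : R) :
  0 < e -> (forall i, `|v ord0 i| < e) -> `|v| < e.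
Proof.
move=> e0 ve; rewrite [ltLHS]/Num.norm /= mx_normrE.
apply/bigmax_ltP; split=> //.
by case=> i j _; rewrite ord1 /=.
Qed.

Lemma rV_norm_coord (R : realType) n (v : 'rV[R]_n) i : `|v ord0 i| <= `|v|.
Proof.
rewrite [leRHS]/Num.norm /= mx_normrE; apply/bigmax_geP; right.
by exists (ord0, i).
Qed.

Lemma continuous_entries (R : realType) (T : topologicalType) m n
    (A : T -> 'M[R]_(m, n)) x :
  (forall i j, {for x, continuous (fun z => A z i j)}) ->
  {for x, continuous A}.
Proof.
move=> cA; rewrite (_ : A = fun z => \sum_i \sum_j A z i j *: delta_mx i j).
  do 2![apply: cvg_big => [|? _]; first exact: add_continuous].
  by apply: cvgZr_tmp; exact: cA.
by apply/funext => z; exact: matrix_sum_delta.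
Qed.

Lemma compact_norm_gt0 (R : realType) (T : topologicalType)
    (V : normedModType R) (K : set T) (h : T -> V) :
  compact K -> continuous h -> (forall x, K x -> h x != 0) ->
  exists2 c : R, 0 < c & forall x, K x -> c <= `|h x|.
Proof.
move=> cK ch h0; have [->|/set0P K0] := eqVneq K set0; first by exists 1.
have [|x Kx hx] := @compact_EVT_min _ _ (fun x => `|h x|) K K0 cK.
  by apply: continuous_subspaceT => x; apply: cvg_norm; exact: ch.
by exists `|h x|; [rewrite normr_gt0 h0// -inE|move=> z Kz; rewrite hx// inE].
Qed.

(** * Continuously differentiable maps *)

Section C1.
Variables (R : realType) (V : normedModType R).

(** The derivative is part of the data so that the closure properties below
    can be read off from the differentiation rules. Its continuity is only
    required in each direction, which in finite dimension is that of all the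
    entries of the jacobian. *)
Definition C1 (W : normedModType R) (u : V -> W) := exists du : V -> V -> W,
  (forall x, is_diff x u (du x)) /\ forall v, continuous (du^~ v).

Lemma C1_continuous (W : normedModType R) (u : V -> W) : C1 u -> continuous u.
Proof.
move=> [du [udu _]] x; apply: differentiable_continuous.
by have := udu x.
Qed.

Lemma C1_cst (W : normedModType R) (a : W) : C1 (cst a).
Proof.
by exists (fun=> 0); split=> [x|v x]; [exact: is_diff_cst|exact: cvg_cst].
Qed.

Lemma C1D (W : normedModType R) (u v : V -> W) : C1 u -> C1 v -> C1 (u + v).
Proof.
move=> [du [udu cu]] [dv [vdv cv]]; exists (fun x => du x + dv x).
by split=> [x|w x]; [exact: is_diffD|apply: cvgD; [exact: cu|exact: cv]].
Qed.

Lemma C1M (u v : V -> R) : C1 u -> C1 v -> C1 (u * v).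
Proof.
move=> Cu Cv; have := C1_continuous Cu; have := C1_continuous Cv.
move: Cu Cv => [du [udu cu]] [dv [vdv cv]] v_cont u_cont.
exists (fun x => u x *: dv x + v x *: du x).
split=> [x|w x]; first exact: is_diffM.
by apply: cvgD; apply: cvgM; [exact: u_cont|exact: cv|exact: v_cont|exact: cu].
Qed.

Lemma C1_scalel (W : normedModType R) (k : V -> R) (a : W) :
  C1 k -> C1 (fun x => k x *: a).
Proof.
move=> [dk [kdk ck]]; exists (fun x v => dk x v *: a); split=> [x|v x].
  have dx := kdk x; apply: DiffDef; first exact: differentiableZl.
  by rewrite diffZl// diff_val.
by apply: cvgZr_tmp; exact: ck.
Qed.

Lemma C1_sum (W : normedModType R) I (r : seq I) (u : I -> V -> W) :
  (forall i, C1 (u i)) -> C1 (fun x => \sum_(i <- r) u i x).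
Proof.
move=> Cu; rewrite (_ : (fun _ => _) = \sum_(i <- r) u i).
  by elim/big_ind: _ => //; [exact: C1_cst|exact: C1D].
by apply/funext => x; rewrite fct_sumE.
Qed.

Lemma C1_prod I (r : seq I) (u : I -> V -> R) :
  (forall i, C1 (u i)) -> C1 (fun x => \prod_(i <- r) u i x).
Proof.
move=> Cu; elim: r => [|i r IHr].
  rewrite (_ : (fun _ => _) = cst 1); first exact: C1_cst.
  by apply/funext => x; rewrite big_nil.
rewrite (_ : (fun _ => _) = u i * (fun x => \prod_(j <- r) u j x)).
  exact: C1M.
by apply/funext => x; rewrite big_cons.
Qed.

Lemma C1X (u : V -> R) k : C1 u -> C1 (fun x => u x ^+ k).
Proof.
move=> Cu; rewrite (_ : (fun _ => _) = fun x => \prod_(i < k) u x).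
  exact: C1_prod.
by apply/funext => x; rewrite prodr_const card_ord.
Qed.

Lemma C1_meval n (P : mpoly n R) (u : 'I_n -> V -> R) :
  (forall i, C1 (u i)) -> C1 (fun x => meval (u^~ x) P).
Proof.
move=> Cu; under eq_fun do rewrite mevalE.
apply: C1_sum => m.
rewrite (_ : (fun _ => _) =
  cst (mcoeff m P) * (fun x => \prod_i u i x ^+ m i))//.
by apply: C1M; [exact: C1_cst|apply: C1_prod => i; exact: C1X].
Qed.

Lemma C1_sqrt (u : V -> R) : C1 u -> (forall x, 0 < u x) ->
  C1 (fun x => Num.sqrt (u x)).
Proof.
move=> Cu u0; have u_cont := C1_continuous Cu.
move: Cu => [du [udu cu]].
exists (fun x v => du x v *: (2 * Num.sqrt (u x))^-1); split=> [x|v x].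
  have sqrt_der := is_derive1_sqrt (u0 x).
  have sqrt_diff :
      is_diff (u x) (@Num.sqrt R) ( *:%R ^~ (2 * Num.sqrt (u x))^-1).
    have sqrt_d : differentiable (@Num.sqrt R) (u x).
      by apply/derivable1_diffP; exact: ex_derive.
    apply: DiffDef => //.
    by rewrite diff1E// derive1E derive_val.
  exact: (is_diff_comp (udu x)).
apply: cvgM; first exact: cu.
apply: cvgV; first by rewrite mulf_neq0// gt_eqF// sqrtr_gt0.
apply: cvgM; first exact: cvg_cst.
by apply: continuous_comp; [exact: u_cont|exact: sqrt_continuous].
Qed.

End C1.

Lemma C1_coord (R : realType) n i : C1 (fun x : 'rV[R]_n => x ord0 i).
Proof.
exists (fun (_ v : 'rV[R]_n) => v ord0 i); split=> [x|v x];
  last exact: (@cst_continuous _ _ (v ord0 i) x).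
have @l : {linear 'rV[R]_n -> R}.
  by exists (fun v : 'rV[R]_n => v ord0 i); do 2![eexists]; do ?[constructor];
     rewrite ?mxE// => ? *; rewrite ?mxE//; move=> ?; rewrite !mxE.
have lc : continuous l by exact: coord_continuous.
rewrite (_ : (fun _ => _) = l)//; apply: DiffDef.
  exact: linear_differentiable.
by rewrite diff_lin.
Qed.

Lemma C1_rV (R : realType) (V : normedModType R) n (u : V -> 'rV[R]_n) :
  (forall i, C1 (fun x => u x ord0 i)) -> C1 u.
Proof.
move=> Cu; rewrite (_ : u = fun x => \sum_i u x ord0 i *: delta_mx ord0 i).
  by apply: C1_sum => i; exact: C1_scalel.
by apply/funext => x; exact: row_sum_delta.
Qed.

Lemma C1_C1_on (R : realType) n (u : 'rV[R]_n -> 'rV[R]_n) W :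
  C1 u -> C1_on u W.
Proof.
move=> [du [udu cu]] x _; split; first by have := udu x.
apply: continuous_entries => i j.
rewrite (_ : (fun _ => _) = fun z => du z (delta_mx ord0 i) ord0 j).
  apply: (@continuous_comp _ _ _ (du^~ (delta_mx ord0 i)) (fun v => v ord0 j)).
    exact: cu.
  exact: coord_continuous.
by apply/funext => z; rewrite !mxE (@diff_val _ _ _ _ _ _ _ (udu z)).
Qed.

(** * Behaviour of polynomial maps at infinity *)

(** For small [t > 0], the map [F] seen from afar, normalized so that the terms
    of degree [d] keep their size. *)
Definition rescale (R : realType) n d (t : R) (F : 'rV[R]_n -> 'rV[R]_n)
  (x : 'rV[R]_n) := t ^+ d *: F (t^-1 *: x).

Lemma normr_monom (R : realType) n d (m : multinom n) (x : 'I_n -> R) M :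
  1 <= M -> (forall i, `|x i| <= M) -> (mdeg m <= d)%N ->
  `|\prod_i x i ^+ m i| <= M ^+ d.
Proof.
move=> M1 xM md; rewrite normr_prod.
apply: (@le_trans _ _ (M ^+ mdeg m)); last exact: ler_weXn2l.
rewrite mdegE -prodrXr; apply: ler_prod => i _.
rewrite normr_ge0 normrX /= lerXn2r ?nnegrE ?(le_trans ler01 M1)//.
Qed.

Lemma meval_pihomog (R : realType) n d (P : mpoly n R) (x : 'I_n -> R) :
  meval x (pihomog mdeg d P) =
  \sum_(m <- msupp P) (if mdeg m == d then mcoeff m P * \prod_i x i ^+ m i
                       else 0).
Proof.
rewrite pihomogE raddf_sum/= big_mkcond/=; apply: eq_bigr => m _.
by case: ifP => // _; rewrite mevalZ mevalX.
Qed.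

(** A monomial of degree [k] is multiplied by [t ^+ (d - k)], which is 1 for
    [k = d] and at most [t] for [k < d]. *)
Lemma meval_rescale_le (R : realType) n d (P : mpoly n R) (x : 'I_n -> R) t M :
  (mmeasure mdeg P <= d.+1)%N -> 0 < t <= 1 -> 1 <= M ->
  (forall i, `|x i| <= M) ->
  `|t ^+ d * meval (fun i => t^-1 * x i) P - meval x (pihomog mdeg d P)| <=
  t * ((\sum_(m <- msupp P) `|mcoeff m P|) * M ^+ d).
Proof.
move=> Pd /andP[t0 t1] M1 xM.
have degP m : m \in msupp P -> (mdeg m <= d)%N.
  by move=> /mmeasure_mnm_lt => /(_ mdeg) /leq_trans/(_ Pd).
rewrite meval_pihomog mevalE !mulr_sumr mulr_suml mulr_sumr -sumrB.
apply: le_trans (ler_norm_sum _ _ _) _.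
rewrite big_seq [leRHS]big_seq; apply: ler_sum => m /degP md.
have -> : \prod_i (t^-1 * x i) ^+ m i = t^-1 ^+ mdeg m * \prod_i x i ^+ m i.
  under eq_bigr do rewrite exprMn.
  by rewrite big_split/= mdegE -prodrXr.
have -> : t ^+ d * (mcoeff m P * (t^-1 ^+ mdeg m * \prod_i x i ^+ m i)) =
    t ^+ (d - mdeg m) * (mcoeff m P * \prod_i x i ^+ m i).
  rewrite -{1}(subnK md) exprD exprVn; field.
  by rewrite expf_neq0// gt_eqF.
have monM := normr_monom M1 xM md.
case: eqP => [->|/eqP mnd].
  rewrite subnn mul1r subrr normr0.
  by rewrite !mulr_ge0// ?exprn_ge0 ?ltW// (lt_le_trans ltr01).
rewrite subr0 !normrM; apply: ler_pM => //.
  rewrite normrX gtr0_norm// -[leRHS]expr1 ler_wiXn2l// ?ltW//.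
  by rewrite subn_gt0 ltn_neqAle mnd.
by rewrite ler_wpM2l.
Qed.

Lemma pdegree_coord (R : realType) n (f : polymap R n) i :
  (mmeasure mdeg (f ord0 i) <= (pdegree f).+1)%N.
Proof.
apply: leq_trans (leqSpred _) _; rewrite ltnS.
exact: (@leq_bigmax _ (fun i => (mmeasure mdeg (f ord0 i)).-1)%N).
Qed.

(** The perturbation disappears in the limit: its degree being smaller than
    that of [f], the maps [f + p] and [f] have the same part of degree
    [pdegree f]. *)
Lemma rescale_peval_cvg (R : realType) n (f p : polymap R n) (M e : R) :
  (pdegree p < pdegree f)%N -> 1 <= M -> 0 < e ->
  \forall t \near 0^'+, forall x, `|x| <= M ->
    `|rescale (pdegree f) t (peval (f + p)) x - peval (plead f) x| < e.
Proof.
move=> pf M1 e0.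
pose P i := f ord0 i + p ord0 i.
pose C i := (\sum_(m <- msupp (P i)) `|mcoeff m (P i)|) * M ^+ pdegree f.
have C0 i : 0 <= C i.
  by rewrite mulr_ge0 ?sumr_ge0// exprn_ge0// (le_trans ler01).
(* [K] is a common bound of the [C i], positive so that one can divide by it. *)
pose K := 1 + \sum_i C i.
have K0 : 0 < K by rewrite ltr_pwDl// sumr_ge0.
near=> t => x xM.
have t0 : 0 < t by near: t; exact: nbhs_right_gt.
have t1 : t <= 1 by near: t; exact: nbhs_right_le.
have tK : t * K < e.
  by rewrite -ltr_pdivlMr//; near: t; apply: nbhs_right_lt; exact: divr_gt0.
apply: rV_norm_lt => // i; apply: le_lt_trans tK.
apply: (@le_trans _ _ (t * C i)); last first.
  rewrite ler_wpM2l ?(ltW t0)// /K (bigD1 i)//= addrCA lerDl.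
  by rewrite addr_ge0// sumr_ge0.
rewrite !mxE.
have -> : pihomog mdeg (pdegree f) (f ord0 i) =
    pihomog mdeg (pdegree f) (P i).
  rewrite pihomogD [X in _ + X](_ : _ = 0) ?addr0// pihomogE big1_seq//.
  move=> m /andP[/eqP md /(mmeasure_mnm_lt mdeg)].
  by move=> /leq_trans/(_ (pdegree_coord p i)); rewrite md ltnS leqNgt pf.
rewrite (_ : (t^-1 *: x) ord0 = fun j => t^-1 * x ord0 j); last first.
  by apply/funext => j; rewrite mxE.
apply: meval_rescale_le => //.
- apply: leq_trans (mmeasureD_le _ _ _) _; rewrite geq_max pdegree_coord/=.
  by rewrite (leq_trans (pdegree_coord p i))// ltnW.
- by rewrite t0.
- by move=> j; exact: le_trans (rV_norm_coord _ _) xM.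
Unshelve. all: by end_near.
Qed.

Lemma peval_plead0 (R : realType) n (f : polymap R n) :
  (0 < pdegree f)%N -> peval (plead f) 0 = 0.
Proof.
move=> f0; apply/rowP => i; rewrite !mxE meval_pihomog big1// => m _.
case: eqP => // md; suff [j mj] : exists j, m j != 0%N.
  by rewrite (bigD1 j)//= mxE expr0n (negbTE mj) mul0r mulr0.
apply/existsP; apply: contraLR f0; rewrite negb_exists => /forallP m0.
by rewrite -md mdegE big1// => j _; apply/eqP; have := m0 j; rewrite negbK.
Qed.

Lemma C1_rescale (R : realType) n (f : polymap R n) d t i :
  C1 (fun x => rescale d t (peval f) x ord0 i).
Proof.
rewrite (_ : (fun _ => _) = cst (t ^+ d) *
    (fun x : 'rV[R]_n => meval (fun j => t^-1 * x ord0 j) (f ord0 i))).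
  apply: C1M; first exact: C1_cst.
  apply: (@C1_meval _ _ _ _ (fun j (x : 'rV[R]_n) => t^-1 * x ord0 j)) => j.
  by apply: (@C1M _ _ (cst t^-1)); [exact: C1_cst|exact: C1_coord].
apply/funext => x; rewrite !mxE; congr (_ * _); apply: meval_eq => j.
by rewrite !mxE.
Qed.

Lemma peval_continuous (R : realType) n (f : polymap R n) :
  continuous (peval f).
Proof.
apply: C1_continuous; apply: C1_rV => i.
under eq_fun do rewrite mxE.
apply: (@C1_meval _ _ _ _ (fun j (x : 'rV[R]_n) => x ord0 j)) => j.
exact: C1_coord.
Qed.

(** * Componentwise minima *)

Lemma closed_preimage_continuous (T U : topologicalType) (h : T -> U) D :
  continuous h -> closed D -> closed (h @^-1` D).
Proof. by move=> ch cD; apply: closed_comp => // x _; exact: ch. Qed.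

Lemma vmin_continuous (R : realType) n (T : topologicalType)
    (u v : T -> 'rV[R]_n) :
  continuous u -> continuous v -> continuous (fun x => vmin (u x) (v x)).
Proof.
move=> cu cv x; apply: continuous_entries => i j.
rewrite (_ : (fun _ => _) =
  (fun z => u z ord0 j) \min (fun z => v z ord0 j)); last first.
  by apply/funext => z; rewrite mxE.
apply: continuous_min.
  apply: (@continuous_comp _ _ _ u (fun w : 'rV[R]_n => w ord0 j)).
    exact: cu.
  exact: coord_continuous.
apply: (@continuous_comp _ _ _ v (fun w : 'rV[R]_n => w ord0 j)).
  exact: cv.
exact: coord_continuous.
Qed.

Lemma vmin_dist_lt (R : realType) n (u v u' v' : 'rV[R]_n) e :
  `|u - u'| < e -> `|v - v'| < e -> `|vmin u v - vmin u' v'| < e.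
Proof.
move=> ue ve; apply: rV_norm_lt => [|i]; first exact: le_lt_trans ue.
have := le_lt_trans (rV_norm_coord (u - u') i) ue.
have := le_lt_trans (rV_norm_coord (v - v') i) ve.
rewrite !mxE /Num.min !ltr_norml => /andP[? ?] /andP[? ?]; apply/andP.
by case: (ltP (u _ _)) => ?; case: (ltP (u' _ _)) => ?; split; lra.
Qed.

Lemma vmin_scale_eq0 (R : realType) n (a b : R) (u v : 'rV[R]_n) :
  0 < a -> 0 < b -> (vmin (a *: u) (b *: v) = 0) <-> (vmin u v = 0).
Proof.
move=> a0 b0; have min0 (s t : R) :
    (Num.min (a * s) (b * t) == 0) = (Num.min s t == 0).
  rewrite !eq_le !ge_min !le_min !pmulr_rle0// !pmulr_rge0//.
split=> /rowP uv; apply/rowP => i; have := uv i;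
  by rewrite !mxE => /eqP h; apply/eqP; rewrite ?min0// -min0.
Qed.

Lemma SOL_vmin (R : realType) n (F G : 'rV[R]_n -> 'rV[R]_n) :
  SOL F G = [set x | vmin (F x) (G x) = 0].
Proof.
apply/seteqP; split=> x /=.
  move=> [F0 G0 FG]; apply/rowP => i; rewrite !mxE.
  have /(_ i isT)/eqP := psumr_eq0P (fun j _ => mulr_ge0 (F0 j) (G0 j)) FG.
  by rewrite mulf_eq0 => /orP[] /eqP ->; [rewrite min_l|rewrite min_r].
move=> /rowP FG; split=> [i|i|]; last (apply: big1 => i _); have := FG i;
  rewrite !mxE => m0.
- by rewrite -m0 ge_min lexx.
- by rewrite -m0 ge_min lexx orbT.
- by move: m0; rewrite /Num.min; case: ifP => _ ->; rewrite ?mul0r ?mulr0.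
Qed.

(** The formula [min (a, b) = (a + b - |a - b|) / 2] with [|c|] replaced by
    [sqrt (c^2 + e^2)], which is smooth and exceeds [|c|] by at most [e]. *)
Definition smooth_min (R : realType) n (e : R) (u v : 'rV[R]_n) : 'rV[R]_n :=
  \row_i ((u ord0 i + v ord0 i
           - Num.sqrt ((u ord0 i - v ord0 i) ^+ 2 + e ^+ 2)) / 2).

Lemma smooth_min_dist_lt (R : realType) n (e : R) (u v : 'rV[R]_n) :
  0 < e -> `|smooth_min e u v - vmin u v| < e.
Proof.
move=> e0; apply: rV_norm_lt => // i; rewrite !mxE minr_absE.
set c := u ord0 i - v ord0 i.
have c_le : `|c| <= Num.sqrt (c ^+ 2 + e ^+ 2).
  by rewrite -sqrtr_sqr ler_wsqrtr// lerDl sqr_ge0.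
have le_c : Num.sqrt (c ^+ 2 + e ^+ 2) <= `|c| + e.
  rewrite -[leRHS]ger0_norm ?addr_ge0 ?(ltW e0)//.
  rewrite -(sqrtr_sqr (`|c| + e)) ler_wsqrtr//.
  rewrite -(real_normK (num_real c)) sqrrD lerD2r lerDl.
  by rewrite mulrn_wge0// mulr_ge0// (ltW e0).
rewrite ltr_norml; apply/andP; split; lra.
Qed.

Lemma C1_smooth_min (R : realType) (V : normedModType R) n (e : R)
    (u v : V -> 'rV[R]_n) : 0 < e ->
  (forall i, C1 (fun x => u x ord0 i)) ->
  (forall i, C1 (fun x => v x ord0 i)) ->
  C1 (fun x => smooth_min e (u x) (v x)).
Proof.
move=> e0 Cu Cv; apply: C1_rV => i.
pose a x := u x ord0 i; pose b x := v x ord0 i.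
have CN (w : V -> R) : C1 w -> C1 (cst (-1) * w).
  by move=> Cw; apply: C1M => //; exact: C1_cst.
have Cc : C1 (a + cst (-1) * b).
  by apply: C1D; [exact: Cu|apply: CN; exact: Cv].
have Cs : C1 (fun x => Num.sqrt (((a + cst (-1) * b) ^+ 2 + cst (e ^+ 2)) x)).
  apply: C1_sqrt => [|x].
    apply: C1D; last exact: C1_cst.
    by rewrite expr2; apply: C1M.
  by rewrite /= ltr_wpDl ?exprn_gt0// sqr_ge0.
rewrite (_ : (fun _ => _) = (a + b + cst (-1) *
    (fun x => Num.sqrt (((a + cst (-1) * b) ^+ 2 + cst (e ^+ 2)) x))) * cst 2^-1).
  apply: C1M; last exact: C1_cst.
  by apply: C1D; [apply: C1D; [exact: Cu|exact: Cv]|exact: CN].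
by apply/funext => x; rewrite !mxE /= !fctE /= !mulN1r.
Qed.

(** * Roots from a nonzero degree *)

(** Stability of roots. A map [g] close to [h] and without a solution of
    [g x = h x0] in [W] has [h x0] as a regular value for want of preimages, so
    that the degree of [h] in [W] would be its signed count, an empty sum. *)
Lemma local_degree_root (R : realType) n (h : 'rV[R]_n -> 'rV[R]_n) x0 :
  continuous h -> local_degree h x0 != 0 ->
  exists W e, [/\ compact (closure W), 0 < e &
    forall g, C1 g -> (forall x, closure W x -> `|g x - h x| < e) ->
      exists2 x, W x & g x = h x0].
Proof.
move=> ch; rewrite /local_degree; case: xgetP => [k _ [W [adm hW degW]] k0|_];
  last by rewrite eqxx.
have [oW bW _ bdW] := adm.
have Wx0 : W x0 by have : [set x0] x0 by []; rewrite -hW => -[].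
have cW : compact (closure W).
  have [M _ WM] := ex_strict_bound_gt0 bW.
  apply: bounded_closed_compact; last exact: closed_closure.
  exists M; split; first exact: num_real.
  move=> r Mr x clWx.
  have cM : closed [set y : 'rV[R]_n | `|y| <= M].
    apply: (@closed_preimage_continuous _ _ _ [set r : R | r <= M]).
      exact: norm_continuous.
    exact: closed_le.
  apply: le_trans (ltW Mr); apply: (cM x).
  by apply: closure_subset clWx => y /WM/ltW.
have cbd : compact (bd W).
  apply: subclosed_compact cW _; last by move=> x [].
  apply: closedI; first exact: closed_closure.
  by apply: open_closedC; exact: open_interior.
have [e e0 he] : exists2 e : R, 0 < e & forall z, bd W z -> e <= `|h z - h x0|.
  apply: (@compact_norm_gt0 _ _ _ _ (fun z => h z - h x0) cbd) => [|x bdx].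
    move=> x; apply: (@continuousB _ _ _ h (cst (h x0))); first exact: ch.
    exact: cst_continuous.
  by rewrite subr_eq0; apply/eqP => hx; apply: bdW; exists x.
exists W, e; split=> // g Cg gh; apply: contrapT => gN.
move: k0; rewrite -(degW W oW Wx0 (@subset_refl _ W)) /degree.
case: xgetP => [l _ [_ /(_ g) gl]|_]; last by rewrite eqxx.
rewrite -gl ?/signed_count.
  rewrite (_ : W `&` _ = set0) ?fsbig_set0 ?eqxx//.
  by apply/seteqP; split=> // x [Wx gx]; apply: gN; exists x.
split; [|exact: C1_C1_on| |] => [|x Wx gx|x z clWx bdz].
- by apply: continuous_subspaceT; exact: C1_continuous.
- by exfalso; apply: gN; exists x.
- by apply: lt_le_trans (he z bdz); exact: gh.
Qed.

(** * Zeros of minima of polynomial maps *)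

Lemma minlead_continuous (R : realType) n (f g : polymap R n) :
  continuous (minlead f g).
Proof. by apply: vmin_continuous; exact: peval_continuous. Qed.

Section RescaledMin.
Variables (R : realType) (n : nat) (f g p q : polymap R n).
Hypotheses (pf : (pdegree p < pdegree f)%N) (qg : (pdegree q < pdegree g)%N).

Let F := peval (f + p).
Let G := peval (g + q).

Let H t x := vmin (rescale (pdegree f) t F x) (rescale (pdegree g) t G x).

Lemma vmin_rescale_cvg M e : 1 <= M -> 0 < e ->
  \forall t \near 0^'+, forall x, `|x| <= M -> `|H t x - minlead f g x| < e.
Proof.
move=> M1 e0; have Fe := rescale_peval_cvg pf M1 e0.
have Ge := rescale_peval_cvg qg M1 e0; near=> t => x xM.
by apply: vmin_dist_lt; move: x xM; near: t.
Unshelve. all: by end_near.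
Qed.

Lemma vmin_rescale_eq0 t x : 0 < t ->
  (H t x = 0) <-> (vmin (F (t^-1 *: x)) (G (t^-1 *: x)) = 0).
Proof. by move=> t0; apply: vmin_scale_eq0; rewrite exprn_gt0. Qed.

(** A zero [x] of large norm gives, with [t = 1 / |x|], the zero [t *: x] of
    [H t] on the unit sphere, where [minlead f g] is bounded away from 0. *)
Lemma bounded_vmin_zeros :
  (forall x : 'rV[R]_n, minlead f g x = 0 -> x = 0) ->
  bounded_set [set x | vmin (F x) (G x) = 0].
Proof.
move=> minlead_eq0.
have [c c0 mc] : exists2 c : R, 0 < c &
    forall x, [set y | `|y| = 1] x -> c <= `|minlead f g x|.
  apply: compact_norm_gt0 => [||x /= x1].
  - apply: bounded_closed_compact.
      by exists 1; split=> [|r r1 x /= ->]; [exact: num_real|exact: ltW].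
    apply: (@closed_preimage_continuous _ _ _ [set r : R | r = 1]).
      exact: norm_continuous.
    exact: closed_eq.
  - exact: minlead_continuous.
  - apply/eqP => /minlead_eq0 x0; move: x1.
    by rewrite x0 normr0 => /esym/eqP; rewrite oner_eq0.
have [t0 /= t00 Ht] := vmin_rescale_cvg (lexx 1) c0.
exists t0^-1; split=> [|r rt x /= x0]; first exact: num_real.
rewrite leNgt; apply/negP => rx.
have xt : t0^-1 < `|x| by exact: lt_trans rx.
have x_gt0 : 0 < `|x| by rewrite (lt_trans _ xt)// invr_gt0.
pose t := `|x|^-1.
have tx1 : `|t *: x| = 1.
  by rewrite normrZ /t ger0_norm ?invr_ge0// mulVf// gt_eqF.
have t_gt0 : 0 < t by rewrite invr_gt0.
have t_ball : ball_ Num.norm 0 t0 t.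
  by rewrite /ball_/= sub0r normrN gtr0_norm// invf_plt.
have := Ht t t_ball t_gt0 (t *: x); rewrite tx1 => /(_ (lexx _)).
rewrite (_ : H t (t *: x) = 0); first by rewrite sub0r normrN ltNge mc.
by apply/vmin_rescale_eq0; rewrite // scalerA mulVf ?gt_eqF// scale1r.
Qed.

Lemma vmin_zero_exists : minlead f g 0 = 0 ->
  local_degree (minlead f g) 0 != 0 ->
  [set x | vmin (F x) (G x) = 0] !=set0.
Proof.
move=> minlead0 deg0.
have m_cont := @minlead_continuous _ _ f g.
have [W [e [cW e0 rootW]]] := local_degree_root m_cont deg0.
have [M [M1 WM]] : exists M, 1 <= M /\ forall x, closure W x -> `|x| <= M.
  have [M M0 WM] := ex_strict_bound_gt0 (compact_bounded cW).
  exists (M + 1); split=> [|x /WM/ltW]; first by rewrite lerDr ltW.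
  by move=> /le_trans; apply; rewrite lerDl.
(* One half of [e] is for the rescaling and the other for the smoothing. *)
have e2 : 0 < e / 2 by rewrite divr_gt0.
have [t [t0 Ht]] : exists t, 0 < t /\ forall x, `|x| <= M ->
    `|H t x - minlead f g x| < e / 2.
  have He := vmin_rescale_cvg M1 e2; near (0 : R)^'+ => t; exists t; split.
    by near: t; exact: nbhs_right_gt.
  by near: t.
apply: contrapT => FG_neq0.
have H_neq0 x : closure W x -> H t x != 0.
  move=> _; apply/eqP => /(vmin_rescale_eq0 _ t0) FG0.
  by apply: FG_neq0; exists (t^-1 *: x).
have C1F := C1_rescale (f + p) (pdegree f) t.
have C1G := C1_rescale (g + q) (pdegree g) t.
have H_cont : continuous (H t).
  by apply: vmin_continuous; apply: C1_continuous; exact: C1_rV.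
have [d d0 Hd] := compact_norm_gt0 cW H_cont H_neq0.
pose s := Num.min d (e / 2).
have s0 : 0 < s by rewrite lt_min d0.
pose u x := smooth_min s (rescale (pdegree f) t F x) (rescale (pdegree g) t G x).
have uH x : `|u x - H t x| < s by exact: smooth_min_dist_lt.
have [|x clWx|x Wx] := rootW u.
- exact: C1_smooth_min.
- rewrite -(subrK (H t x) (u x)) -addrA (splitr e).
  apply: le_lt_trans (ler_normD _ _) _; apply: ltrD; last exact/Ht/WM.
  by apply: lt_le_trans (uH x) _; rewrite ge_min lexx orbT.
- rewrite minlead0 => ux0; have := uH x; rewrite ux0 sub0r normrN ltNge.
  by move=> /negP; apply; rewrite ge_min Hd//; exact: subset_closure.
Unshelve. all: by end_near.
Qed.

End RescaledMin.

Theorem proposition4p4 (R : realType) (n : nat) (f g : polymap R n)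
    (df_gt0 : (0 < pdegree f)%N) (dg_gt0 : (0 < pdegree g)%N)
    (minlead_eq0 : forall x : 'rV[R]_n, minlead f g x = 0 -> x = 0)
    (deg_minlead : local_degree (minlead f g) 0 != 0)
    (p q : polymap R n)
    (dp : (pdegree p <= pdegree f - 1)%N)
    (dq : (pdegree q <= pdegree g - 1)%N) :
  SOL (peval (f + p)) (peval (g + q)) !=set0 /\
  compact (SOL (peval (f + p)) (peval (g + q))).
Proof.
have pf : (pdegree p < pdegree f)%N by rewrite -(subnK df_gt0) addn1 ltnS.
have qg : (pdegree q < pdegree g)%N by rewrite -(subnK dg_gt0) addn1 ltnS.
rewrite SOL_vmin; split.
  apply: vmin_zero_exists => //.
  by rewrite /minlead !peval_plead0//; apply/rowP => i; rewrite !mxE minxx.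
apply: bounded_closed_compact; first exact: bounded_vmin_zeros.
apply: (@closed_preimage_continuous _ _
  (fun x => vmin (peval (f + p) x) (peval (g + q) x)) [set 0]).
  by apply: vmin_continuous; exact: peval_continuous.
apply: accessible_closed_set1; apply: hausdorff_accessible.
exact: norm_hausdorff.
Qed.
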